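(* Let $m$ and $F$ be positive integers such that $m\geq 3$, $F>2m$ and $m\nmid F$, let $S\in\mathscr I(m,F)$ and let $g$ be a positive integer. Put $Z=\langle\theta(S)\cup\{m\}\rangle\cup\{F+1,\rightarrow\}$, $D(S)=S\setminus Z$, and $$A=\{T(B)\mid B\subseteq D(S)\text{ and }\#T(B)=\operatorname{g}(Z)-g\}.$$ Then $\{T\in[S]\mid\operatorname{g}(T)=g\}=\{Z\cup X\mid X\in A\}$.
   Context: $\mathbb N$ denotes the non-negative integers. A numerical semigroup is a submonoid $S$ of $(\mathbb N,+)$ with $\mathbb N\setminus S$ finite. Its multiplicity $\operatorname{m}(S)$ is the smallest positive integer in $S$; its Frobenius number $\operatorname{F}(S)$ is the largest integer not in $S$; its genus $\operatorname{g}(S)$ is the cardinality of $\mathbb N\setminus S$. A numerical semigroup is irreducible if it cannot be expressed as the intersection of two numerical semigroups properly containing it. $\mathscr L(m,F)$ (respectively $\mathscr I(m,F)$) is the set of all numerical semigroups (respectively all irreducible numerical semigroups) with multiplicity $m$ and Frobenius number $F$. For a numerical semigroup $S$, $\theta(S)=\{s\in S\mid \operatorname{m}(S)<s<\operatorname{F}(S)/2\}$. On $\mathscr L(m,F)$, $S\sim S'$ if and only if $\theta(S)=\theta(S')$, and $[S]=\{S'\in\mathscr L(m,F)\mid S\sim S'\}$. $\langle\mathcal A\rangle$ is the submonoid of $(\mathbb N,+)$ generated by $\mathcal A$; $\{F+1,\rightarrow\}$ is the set of integers $\ge F+1$. For $B\subseteq D(S)$, $T(B)=\bigcup_{b\in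 B}\big((\{b\}+Z)\cap D(S)\big)$, where $\{b\}+Z=\{b+z\mid z\in Z\}$ (so $T(\varnothing)=\varnothing$). $\#$ denotes cardinality. *)

(* Defs.v *)
From mathcomp Require Import all_boot all_order all_algebra finmap.
From mathcomp Require Import boolp classical_sets functions cardinality.

Set Implicit Arguments.
Unset Strict Implicit.
Unset Printing Implicit Defensive.

Import Order.TTheory GRing.Theory Num.Theory.

Local Open Scope classical_set_scope.
Local Open Scope nat_scope.

(* [fset_set A] is empty when [A] is infinite; below [setcard] is only relevant
   for finite sets. *)
Definition setcard (A : set nat) : nat := #|` fset_set A|%fset.

Definition submonoid (S : set nat) : Prop :=
  S 0 /\ forall x y, S x -> S y -> S (x + y).

Definition generated (A : set nat) : set nat := smallest submonoid A.

Definition numerical_semigroup (S : set nat) : Prop :=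
  submonoid S /\ finite_set (~` S).

Definition multiplicity (S : set nat) : nat :=
  let P := [set x | S x /\ 0 < x] in xget 0 (P `&` lbound P).

(* The largest integer, not natural number, outside [S]: it is -1 for
   [S = setT]. *)
Definition frobenius (S : set nat) : int :=
  let G := ~` [set (n%:Z)%R | n in S] in xget (- 1)%R (G `&` ubound G).

Definition genus (S : set nat) : nat := setcard (~` S).

Definition irreducible_semigroup (S : set nat) : Prop :=
  numerical_semigroup S /\
  ~ exists S1 S2 : set nat,
      [/\ numerical_semigroup S1, numerical_semigroup S2,
          S `<` S1, S `<` S2 & S = S1 `&` S2].

Definition semigroups (m F : nat) : set (set nat) :=
  [set S | [/\ numerical_semigroup S, multiplicity S = m
             & frobenius S = (F%:Z)%R]].

Definition irreducibles (m F : nat) : set (set nat) :=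
  [set S | [/\ irreducible_semigroup S, multiplicity S = m
             & frobenius S = (F%:Z)%R]].

Definition theta (S : set nat) : set nat :=
  [set s | [/\ S s, multiplicity S < s
             & ((s%:Z)%:Q < (frobenius S)%:Q / 2)%R]].

Definition theta_equiv (S S' : set nat) : Prop := theta S = theta S'.

Definition theta_class (m F : nat) (S : set nat) : set (set nat) :=
  [set S' | semigroups m F S' /\ theta_equiv S S'].

Definition Zset (m F : nat) (S : set nat) : set nat :=
  generated (theta S `|` [set m]) `|` [set n | F + 1 <= n].

Definition Dset (m F : nat) (S : set nat) : set nat := S `\` Zset m F S.

Definition Tset (m F : nat) (S B : set nat) : set nat :=
  \bigcup_(b in B) ([set b + z | z in Zset m F S] `&` Dset m F S).

(* The difference of genera is taken in [int]: when [g] exceeds the genus of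
   [Z] no [B] qualifies, whereas truncated subtraction would let in
   [B = set0]. *)
Definition Aset (m F : nat) (S : set nat) (g : nat) : set (set nat) :=
  [set Tset m F S B | B in
    [set B | B `<=` Dset m F S /\
      ((setcard (Tset m F S B))%:Z = (genus (Zset m F S))%:Z - g%:Z)%R]].

(* Main.v *)
Require Import Defs.
From mathcomp Require Import all_boot all_order all_algebra finmap.
From mathcomp Require Import boolp classical_sets functions cardinality.
From mathcomp Require Import zify.

Set Implicit Arguments.
Unset Strict Implicit.
Unset Printing Implicit Defensive.

(** An irreducible semigroup [S] with Frobenius number [F] satisfies: [x] or
    [F - x] lies in [S] whenever [x <= F] and [2 x <> F]. Hence every [T] in the
    class of [S] is contained in [S]: an [x > F/2] of [T] outside [S] would give
    [F - x] in [S] below [F/2], so in [T], and [F] would be in [T]. Thus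
    [T] is the union of [Z] and [T \ Z], with [T \ Z] contained in [D(S)] and
    fixed by the operator [B |-> T(B)]. Conversely all elements of [D(S)] exceed
    [F/2], so sums of two of them exceed [F], and the union of [Z] and [T(B)] is
    always a semigroup. *)

Local Open Scope classical_set_scope.
Local Open Scope nat_scope.

Lemma numerical_semigroup_max (S : set nat) (F : nat) :
  submonoid S -> (forall n, F < n -> S n) -> numerical_semigroup S.
Proof.
move=> mS SF; split=> //; apply: (sub_finite_set _ (finite_II F.+1)) => x /= Sx.
by rewrite ltnS leqNgt; apply/negP => /SF.
Qed.

Lemma multiplicityP (S : set nat) (m : nat) : 0 < m ->
  multiplicity S = m <-> S m /\ forall x, S x -> 0 < x -> m <= x.
Proof.
move=> m0; rewrite /multiplicity /=; set P := [set x | _]; split.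
  (* The default value [0] of [xget] is excluded by [0 < m]. *)
  case: xgetP => [_ -> [[Pm1 _] Pm2] <-|_ m0' ]; last by rewrite -m0' in m0.
  by split=> // x Sx x0; apply: Pm2.
move=> [Sm mS].
have Qm : (P `&` lbound P) m by split=> [|x [Sx x0]]; [split|exact: mS].
apply: xget_unique => // y [[Sy y0] Py].
have ym : y <= m := Py m (conj Sm m0).
by apply/eqP; rewrite eqn_leq ym mS.
Qed.

Lemma frobeniusP (S : set nat) (F : nat) :
  frobenius S = F%:Z%R <-> ~ S F /\ forall n, F < n -> S n.
Proof.
rewrite /frobenius /=; set G := (X in X `&` _).
have GE n : G n%:Z%R <-> ~ S n.
  split=> [Gn Sn|nSn [k Sk [kn]]]; first by apply: Gn; exists n.
  by rewrite kn in Sk.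
split.
  (* The default [-1] differs from the natural number [F], so the maximum of [G] is attained. *)
  case: xgetP => // _ -> [/= GF uF] FE; rewrite FE in GF uF.
  split=> [|n Fn]; first exact/GE.
  by apply: contrapT => /GE /uF; rewrite lez_nat leqNgt Fn.
move=> [nSF SF].
have QF : (G `&` ubound G) F%:Z%R.
  split=> [|[n|n] Gn]; [exact/GE| |by []].
  by rewrite lez_nat leqNgt; apply/negP => /SF; apply/GE.
apply: xget_unique => // y [Gy uy].
by apply/eqP; rewrite Order.POrderTheory.eq_le uy ?QF.2 //; exact: QF.1.
Qed.

Lemma half_ratE (s F : nat) :
  ((s%:Z)%:Q < (F%:Z)%:Q / 2)%R = (2 * s < F).
Proof.
rewrite Num.Theory.ltr_pdivlMr // -[X in (_ * X < _)%R]/((2%:Z)%:Q)%R.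
by rewrite -intrM ltr_int mulnC -PoszM ltz_nat.
Qed.

Lemma thetaP (m F : nat) (S : set nat) (s : nat) :
  multiplicity S = m -> frobenius S = F%:Z%R ->
  theta S s <-> [/\ S s, m < s & 2 * s < F].
Proof. by move=> mS FS; rewrite /theta /= mS FS half_ratE. Qed.

Lemma setcard_disjointU (A B : set nat) :
  finite_set A -> finite_set B -> A `&` B = set0 ->
  setcard (A `|` B) = setcard A + setcard B.
Proof.
move=> fA fB AB; rewrite /setcard fset_setU // cardfsU -fset_setI // AB.
by rewrite fset_set0 cardfs0 subn0.
Qed.

(** The gaps of [Z] split into [X] and the gaps that survive in the union; finiteness makes the
    count additive. *)
Lemma genus_disjointU (Z X : set nat) :
  finite_set (~` Z) -> X `<=` ~` Z ->
  genus Z = setcard X + genus (Z `|` X).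
Proof.
move=> fZ XZ; rewrite /genus -setcard_disjointU.
- by congr setcard; rewrite setCU setUIr setUv setIT; apply/esym/setUidPr.
- exact: sub_finite_set fZ.
- by apply: sub_finite_set fZ => x /= nx Zx; apply: nx; left.
- by apply/disjoints_subset => x Xx /= nx; apply: nx; right.
Qed.

Lemma submonoid_generated (A : set nat) : submonoid (generated A).
Proof.
split=> [M [[M0 _] _] //|x y gx gy M hM].
by case: (hM) => -[_ MD] _; apply: MD; [exact: gx|exact: gy].
Qed.

Lemma submonoid_up (M : set nat) (F : nat) :
  submonoid M -> submonoid (M `|` [set n | F + 1 <= n]).
Proof.
move=> [M0 MD]; split=> [|x y]; first by left.
case=> [Mx|/= Fx] [My|/= Fy]; first by left; apply: MD.
all: by right => /=; lia.
Qed.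

(** The only new sums are [h + h] and [h + s]; for [s = 0] the latter is [h] itself, hence the
    restriction to positive [s]. *)
Lemma numerical_semigroup_add (S : set nat) (h : nat) :
  numerical_semigroup S -> S (h + h) ->
  (forall s, S s -> 0 < s -> S (h + s)) -> numerical_semigroup (S `|` [set h]).
Proof.
move=> [[S0 SD] fS] Shh Sh; split; last first.
  by apply: sub_finite_set fS => x /= nx Sx; apply: nx; left.
have Sh' s : S s -> (S `|` [set h]) (h + s).
  by case: s => [_|s Ss]; [right; rewrite /= addn0|left; apply: Sh].
split=> [|x y]; first by left.
case=> [Sx|/= ->] [Sy|/= ->]; [by left; apply: SD| |exact: Sh'|by left].
by rewrite addnC; apply: Sh'.
Qed.

(* With [h] the largest counterexample, [S] is the intersection of
   [S `|` [set h]] and [S `|` [set F]]. *)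
Lemma irreducible_symmetric (S : set nat) (F x : nat) :
  irreducible_semigroup S -> frobenius S = F%:Z%R ->
  x <= F -> 2 * x <> F -> ~ S x -> S (F - x).
Proof.
move=> [nsS irr] /frobeniusP[nSF SF] xF x2 nSx; apply: contrapT => nSFx.
have [[S0 SD] _] := nsS.
pose P h := `[< [/\ h <= F, 2 * h <> F, ~ S h & ~ S (F - h)] >].
have exP : exists h, P h by exists x; apply/asboolP.
have Pub h : P h -> h <= F by move=> /asboolP[].
case: (ex_maxnP exP Pub) => h /asboolP[hF h2 nSh nSFh] hmax.
(* [F - h] is a counterexample too, so maximality gives [F - h <= h], and equality is excluded by
   [h2]. *)
have Fh : F < 2 * h.
  have : P (F - h) by apply/asboolP; rewrite subKn //; split=> //; lia.
  by move=> /hmax; lia.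
have hNF : h <> F by move=> hE; apply: nSFh; rewrite hE subnn.
apply: irr; exists (S `|` [set h]), (S `|` [set F]); split.
- apply: numerical_semigroup_add => // [|s Ss s0]; first by apply: SF; lia.
  (* A gap [h + s] would be a larger counterexample: if its mirror [F - (h + s)] were in [S], adding
     [s] would put [F - h] in [S]. *)
  apply: contrapT => nShs.
  have hsF : h + s <= F by rewrite leqNgt; apply/negP => /SF.
  suff /hmax : P (h + s) by lia.
  apply/asboolP; split=> //; first lia.
  move=> SFhs; apply: nSFh.
  by have -> : F - h = (F - (h + s)) + s by [lia]; apply: SD.
- by apply: numerical_semigroup_add => // [|s _ s0]; apply: SF; lia.
- by split=> [y|/(_ h)]; [left|move=> /(_ (or_intror erefl))].
- by split=> [y|/(_ F)]; [left|move=> /(_ (or_intror erefl))].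
- apply/seteqP; split=> [y Sy|y]; first by split; left.
  by case=> -[//|/= yh] [//|/= yF]; case: hNF; rewrite -yh.
Qed.

Lemma Zset_sub (m F : nat) (S T : set nat) :
  submonoid T -> theta S `<=` T -> T m -> (forall n, F < n -> T n) ->
  Zset m F S `<=` T.
Proof.
move=> mT thT Tm TF x [gx|/= Fx]; last by apply: TF; lia.
by apply: gx; split=> // y [/thT //|/= ->].
Qed.

(** Such an [x] is [0], [m] or an element of [theta S], as nothing in [S] lies strictly between [0]
    and [m]. *)
Lemma Zset_small (m F : nat) (S : set nat) (x : nat) :
  0 < m -> multiplicity S = m -> frobenius S = F%:Z%R ->
  S x -> 2 * x < F -> Zset m F S x.
Proof.
move=> m0 mS FS Sx xF; left.
have [-> | x0] := posnP x; first by case: (submonoid_generated (theta S `|` [set m])).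
move=> M [_ sM]; apply: sM.
have /(multiplicityP _ m0)[_ /(_ x Sx x0)] := mS.
by rewrite leq_eqVlt => /orP[/eqP ->|mx]; [right|left; apply/(thetaP _ mS FS)].
Qed.

Lemma theta_class_sub (m F : nat) (S T : set nat) :
  0 < m -> irreducibles m F S -> theta_class m F S T -> T `<=` S.
Proof.
move=> m0 [irrS mS FS] [[[[T0 TD] fT] mT FT] thST] x Tx; apply: contrapT => nSx.
have [Sm _] := (multiplicityP S m0).1 mS.
have [Tm mTmin] := (multiplicityP T m0).1 mT.
have [nSF SF] := (frobeniusP S F).1 FS.
have [nTF TF] := (frobeniusP T F).1 FT.
have [[S0 SD] _] := irrS.1.
(* As the two thetas agree, the [Zset] of each semigroup lies in the other, so [S] and [T] coincide
   below [F / 2]. *)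
have ZT : Zset m F S `<=` T.
  by apply: Zset_sub => //; rewrite thST => y /(thetaP _ mT FT)[].
have ZS : Zset m F T `<=` S.
  by apply: Zset_sub => //; rewrite -thST => y /(thetaP _ mS FS)[].
have xF : x <= F by rewrite leqNgt; apply/negP => /SF.
have [xlt|Fx|xE] := ltngtP (2 * x) F.
- by apply: nSx; apply: ZS; apply: Zset_small.
- have SFx : S (F - x) by apply: (irreducible_symmetric irrS FS) => //; lia.
  apply: nTF; rewrite -(subnK xF); apply: TD => //.
  by apply: ZT; apply: Zset_small => //; lia.
- by apply: nTF; rewrite -xE mul2n -addnn; apply: TD.
Qed.

(** Elements of [S] below [F / 2] are already in [Zset], and [F / 2] is not in [S] because its
    double is a gap. *)
Lemma Dset_gt_half (m F : nat) (S : set nat) (x : nat) :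
  0 < m -> semigroups m F S -> Dset m F S x -> F < 2 * x.
Proof.
move=> m0 [[[_ SD] _] mS FS] [Sx nZx]; have [nSF _] := (frobeniusP S F).1 FS.
have [xlt|//|xE] := ltngtP (2 * x) F; first by case: nZx; apply: Zset_small.
by case: nSF; rewrite -xE mul2n -addnn; apply: SD.
Qed.

Lemma Tset_sub_Dset (m F : nat) (S B : set nat) : Tset m F S B `<=` Dset m F S.
Proof. by move=> x [b _ []]. Qed.

Lemma submonoid_Zset (m F : nat) (S : set nat) : submonoid (Zset m F S).
Proof. exact/submonoid_up/submonoid_generated. Qed.

Lemma theta_class_Tset (m F : nat) (S B : set nat) :
  0 < m -> semigroups m F S -> B `<=` Dset m F S ->
  theta_class m F S (Zset m F S `|` Tset m F S B).
Proof.
move=> m0 sgS BD; set Z := Zset m F S; set X := Tset m F S B; set T := Z `|` X.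
have [[[S0 SD] _] mS FS] := sgS.
have [Sm mmin] := (multiplicityP S m0).1 mS.
have [nSF SF] := (frobeniusP S F).1 FS.
have ZS : Z `<=` S by apply: Zset_sub => // y /(thetaP _ mS FS)[].
have TS : T `<=` S by move=> x [/ZS //|/Tset_sub_Dset[]].
have [Z0 ZD] : submonoid Z := submonoid_Zset m F S.
have ZF n : F < n -> Z n by move=> Fn; right => /=; lia.
(* Writing [x = b + z'], the sum is [b + (z' + z)] and lies in [S]: it is in [Z], or in [Dset] and
   then in [X] through the same [b]. *)
have XZ x z : X x -> Z z -> T (x + z).
  move=> Xx Zz; have [Zxz|nZxz] := pselect (Z (x + z)); first by left.
  have Sxz : S (x + z) by apply: SD; [apply: TS; right|apply: ZS].
  right; have [b Bb [[z' Zz' xE] _]] := Xx.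
  exists b => //; split=> //; exists (z' + z); first exact: ZD.
  by rewrite addnA xE.
have mT : submonoid T.
  split=> [|x y]; first by left.
  case=> [Zx|Xx] [Zy|Xy]; [by left; apply: ZD| |exact: XZ|].
    by rewrite addnC; apply: XZ.
  have := Dset_gt_half m0 sgS (Tset_sub_Dset Xx).
  have := Dset_gt_half m0 sgS (Tset_sub_Dset Xy).
  by left; apply: ZF; lia.
have mulT : multiplicity T = m.
  apply/multiplicityP => //; split=> [|x /TS]; last exact: mmin.
  by left; left=> M [_ sM]; apply: sM; right.
have froT : frobenius T = F%:Z%R.
  by apply/frobeniusP; split=> [/TS //|n Fn]; left; apply: ZF.
split; first by split=> //; apply: (@numerical_semigroup_max _ F) => // n Fn; left; apply: ZF.
apply/seteqP; split=> x.
  move=> thx; have [_ mx xF] := (thetaP x mS FS).1 thx.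
  by apply/(thetaP x mulT froT); split=> //; left; left=> M [_ sM]; apply: sM; left.
by move=> /(thetaP x mulT froT)[/TS Sx mx xF]; apply/(thetaP x mS FS).
Qed.

(** Translating by elements of [Zset] does not leave [T], and the translation by [0] recovers every
    element. *)
Lemma Tset_setD (m F : nat) (S T : set nat) :
  submonoid T -> Zset m F S `<=` T -> T `<=` S ->
  Tset m F S (T `\` Zset m F S) = T `\` Zset m F S.
Proof.
move=> [T0 TD] ZT TS; apply/seteqP; split=> x.
  by move=> [b [Tb _] [[z Zz <-] [_ nZ]]]; split=> //; apply: TD => //; apply: ZT.
move=> [Tx nZx]; exists x => //; split; last by split=> //; apply: TS.
by exists 0; rewrite ?addn0 //; case: (submonoid_Zset m F S).
Qed.

Theorem mainTheorem20 (m F : nat) (S : set nat) (g : nat)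
    (m_pos : 0 < m) (F_pos : 0 < F)
    (m_ge3 : 3 <= m) (F_gt : 2 * m < F) (m_ndvd_F : ~~ (m %| F))
    (S_irr : irreducibles m F S) (g_pos : 0 < g) :
  [set T | theta_class m F S T /\ genus T = g] =
  [set Zset m F S `|` X | X in Aset m F S g].
Proof.
have sgS : semigroups m F S by case: S_irr => -[].
have genusE X : X `<=` Dset m F S ->
    genus (Zset m F S) = setcard X + genus (Zset m F S `|` X).
  move=> XD; apply: genus_disjointU => [|x /XD[]//].
  suff [] : numerical_semigroup (Zset m F S) by [].
  apply: (@numerical_semigroup_max _ F) => [|n Fn]; first exact: submonoid_Zset.
  by right => /=; lia.
apply/seteqP; split=> [T [ST gT]|_ [_ [B [BD cB] <-] <-]] /=; last first.
  split; first exact: theta_class_Tset.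
  (* By [genusE], the cardinality condition [cB] says exactly that the union has genus [g]. *)
  by have := genusE _ (@Tset_sub_Dset m F S B); lia.
have TS := theta_class_sub m_pos S_irr ST.
have [[[mT fT] mulT froT] thST] := ST.
have ZT : Zset m F S `<=` T.
  have [Tm _] := (multiplicityP T m_pos).1 mulT.
  have [_ TF] := (frobeniusP T F).1 froT.
  by apply: Zset_sub => //; rewrite thST => y /(thetaP _ mulT froT)[].
have TE : Zset m F S `|` (T `\` Zset m F S) = T by rewrite setUC setDKU.
have BD : T `\` Zset m F S `<=` Dset m F S by move=> x [/TS].
(* The same set serves as [X] and as [B], being a fixed point of [Tset]. *)
exists (T `\` Zset m F S) => //; exists (T `\` Zset m F S); last exact: Tset_setD.
split=> //; rewrite Tset_setD //.
by have := genusE _ BD; rewrite TE gT; lia.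
Qed.
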